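(* In the FSISIC-with-AWGN setting below, let a codeword $x_1^n\in\mathcal C$ be transmitted from an initial state $s_1\in\mathcal S_0$, let $(\tilde e_1,\dots,\tilde e_n)$ be the resulting edge-path (so $\tilde e_i=(i,s_i,\eta(x_i,s_i),x_i)$ with $s_{i+1}=\eta(x_i,s_i)$), and let $\mathbf c=(c_1,\dots,c_n)$ with $c_i=a(\tilde e_i)$ be the symbol-wise signal-space codeword. The received sequence is $\mathbf y=\mathbf c+\mathbf v$, where $v_1,\dots,v_n$ are i.i.d. $\mathcal N(0,\sigma^2)$. Let $g\in\mathcal P_{\mathcal T}(H)$ be fixed (independent of $\mathbf v$), let $\mathbf p=(p_1,\dots,p_n)$ with $p_i=\sum_{e:\,t(e)=i}g(e)a(e)$ be its signal-space projection, and assume $\mathbf p\neq\mathbf c$. Define $\|\mathbf d\|^2=\sum_{i=1}^n(c_i-p_i)^2$, $\sigma_p^2=\sum_{e\in\mathcal E}g(e)a(e)^2-\sum_{i=1}^np_i^2$, and $d_{gen}^2(\mathbf c,\mathbf p)=\frac{(\|\mathbf d\|^2+\sigma_p^2)^2}{\|\mathbf d\|^2}$. Then the pairwise error probability $$\Pr(\mathbf c\to\mathbf p)=\Pr\Big\{\sum_{e\in\mathcal E}g(e)\big(y_{t(e)}-a(e)\big)^2\le\sum_{i=1}^n(y_i-c_i)^2\Big\}$$ equals $Q\!\left(\frac{d_{gen}(\mathbf c,\mathbf p)}{2\sigma}\right)$, where $d_{gen}=\frac{\|\mathbf d\|^2+\sigma_p^2}{\|\mathbf d\|}$ and $Q(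z)=\int_z^\infty\frac{1}{\sqrt{2\pi}}e^{-u^2/2}\,du$.
   Context: Let $\mathcal C\subseteq\{0,1\}^n$ be a binary linear code with parity-check matrix $H$, and let $\mathcal I$ be the collection of sets of column indices participating in each row (parity check) of $H$. For $I\in\mathcal I$ define $\mathrm{LCP}(I)=\bigcap_{S\subseteq I,\ |S|\text{ odd}}\{\mathbf f\in[0,1]^n:\sum_{i\in S}f_i-\sum_{i\in I\setminus S}f_i\le |S|-1\}$ and $\mathcal P(H)=\bigcap_{I\in\mathcal I}\mathrm{LCP}(I)$. FSISIC with AWGN: finite state set $\mathcal S$, functions $\eta:\{0,1\}\times\mathcal S\to\mathcal S$ (next state) and $\alpha:\mathcal S\times\{0,1\}\to\mathbb R$ (noiseless output), noise variance $\sigma^2>0$, and a nonempty set $\mathcal S_0\subseteq\mathcal S$ of allowed initial states. The trellis edge set is $\mathcal E=\{(i,s,\eta(x,s),x): i\in\{1,\dots,n\},\ x\in\{0,1\},\ s\in\mathcal S\text{ (with } s\in\mathcal S_0\text{ if } i=1)\}$; for $e=(i,s,s',x)$ write $t(e)=i$, $s(e)=s$, $s'(e)=s'$, $x(e)=x$, $a(e)=\alpha(s,x)$. The trellis polytope $\mathcal T$ is the set of $g:\mathcal E\to[0,1]$ with $\sum_{e:\,t(e)=1}g(e)=1$ and, for every $i=1,\dots,n-1$ and $j\in\mathcal S$, $\sum_{e:\,t(e)=i,\,s'(e)=j}g(e)=\sum_{e:\,t(e)=i+1,\,s(e)=j}g(e)$. The projection $\mathcal Q$ maps $g$ to $\mathbf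 f=\mathcal Qg$ with $f_i=\sum_{e:\,t(e)=i,\,x(e)=1}g(e)$. The trellis-wise relaxed polytope is $\mathcal P_{\mathcal T}(H)=\{g\in\mathcal T:\mathcal Qg\in\mathcal P(H)\}$. *)

(* Defs.v *)
From HB Require Import structures.
From mathcomp Require Import all_boot all_order all_algebra.
From mathcomp Require Import all_classical all_reals all_analysis.
Set Implicit Arguments. Unset Strict Implicit. Unset Printing Implicit Defensive.
Import Order.TTheory GRing.Theory Num.Theory.
Local Open Scope classical_set_scope.
Local Open Scope ring_scope.

Definition is_codeword (m n : nat) (H : 'M['F_2]_(m, n)) (x : 'I_n -> bool) : Prop :=
  forall j : 'I_m, \sum_(i < n) H j i * (x i)%:R = 0.

Definition check_support (m n : nat) (H : 'M['F_2]_(m, n)) (j : 'I_m) : {set 'I_n} :=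
  [set i | H j i != 0].

Definition in_LCP {R : realType} (n : nat) (I : {set 'I_n}) (f : 'I_n -> R) : Prop :=
  (forall i, 0 <= f i <= 1) /\
  (forall S : {set 'I_n}, S \subset I -> odd #|S| ->
     \sum_(i in S) f i - \sum_(i in I :\: S) f i <= (#|S|)%:R - 1).

Definition in_PH {R : realType} (m n : nat) (H : 'M['F_2]_(m, n)) (f : 'I_n -> R) : Prop :=
  (forall i, 0 <= f i <= 1) /\ (forall j : 'I_m, in_LCP (check_support H j) f).

(* An edge (i, s, eta(x,s), x) is represented by the triple (i, s, x) with
   i : 'I_n (0-based time), s : S the starting state, x the input bit;
   its ending state is eta x s. *)
Definition edge (n : nat) (S : finType) := ('I_n * S * bool)%type.

Section Trellis.
Context {R : realType} (n : nat) (S : finType)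
        (eta : bool -> S -> S) (alpha : S -> bool -> R) (S0 : {set S}).

Definition e_t (e : edge n S) : 'I_n := e.1.1.
Definition e_s (e : edge n S) : S := e.1.2.
Definition e_x (e : edge n S) : bool := e.2.
Definition e_s' (e : edge n S) : S := eta (e_x e) (e_s e).
Definition e_a (e : edge n S) : R := alpha (e_s e) (e_x e).

Definition in_E (e : edge n S) : bool := (val (e_t e) == 0%N) ==> (e_s e \in S0).

Definition in_trellis_polytope (g : edge n S -> R) : Prop :=
  (forall e, in_E e -> 0 <= g e <= 1) /\
  \sum_(e | in_E e && (val (e_t e) == 0%N)) g e = 1 /\
  (forall (i : nat) (j : S), (i.+1 < n)%N ->
     \sum_(e | [&& in_E e, val (e_t e) == i & e_s' e == j]) g e =
     \sum_(e | [&& in_E e, val (e_t e) == i.+1 & e_s e == j]) g e).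

Definition proj_Q (g : edge n S -> R) (i : 'I_n) : R :=
  \sum_(e | [&& in_E e, e_t e == i & e_x e]) g e.

Definition in_PT (m : nat) (H : 'M['F_2]_(m, n)) (g : edge n S -> R) : Prop :=
  in_trellis_polytope g /\ in_PH H (proj_Q g).

Definition sig_proj (g : edge n S -> R) (i : 'I_n) : R :=
  \sum_(e | in_E e && (e_t e == i)) g e * e_a e.

Definition sigma_p2 (g : edge n S -> R) : R :=
  \sum_(e | in_E e) g e * e_a e ^+ 2 - \sum_(i < n) sig_proj g i ^+ 2.

(* state sequence of the transmitted path: state k (0-based) = s_{k+1} *)
Definition ext_bits (x : 'I_n -> bool) (k : nat) : bool :=
  oapp x false (insub k : option 'I_n).

Fixpoint path_state (s1 : S) (x : 'I_n -> bool) (k : nat) : S :=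
  if k is k'.+1 then eta (ext_bits x k') (path_state s1 x k') else s1.

Definition path_edge (s1 : S) (x : 'I_n -> bool) (i : 'I_n) : edge n S :=
  (i, path_state s1 x i, x i).

Definition sig_codeword (s1 : S) (x : 'I_n -> bool) (i : 'I_n) : R :=
  e_a (path_edge s1 x i).

End Trellis.

Definition dist2 {R : realType} (n : nat) (c p : 'I_n -> R) : R :=
  \sum_(i < n) (c i - p i) ^+ 2.

Definition d_gen {R : realType} (n : nat) (c p : 'I_n -> R) (sp2 : R) : R :=
  (dist2 c p + sp2) / Num.sqrt (dist2 c p).

Definition Qfun {R : realType} (z : R) : \bar R :=
  (\int[lebesgue_measure]_(u in `[z, +oo[)
      ((Num.sqrt (pi *+ 2))^-1 * expR (- (u ^+ 2) / 2))%:E)%E.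

Definition mutually_independent {d : measure_display} {T : measurableType d}
  {R : realType} (P : probability T R) (n : nat) (v : 'I_n -> T -> R) : Prop :=
  forall (J : {set 'I_n}) (B : 'I_n -> set R), (forall i, measurable (B i)) ->
    P [set w | forall i, i \in J -> B i (v i w)] =
    (\prod_(i in J) P (v i @^-1` B i))%E.

(* Main.v *)
Require Import Defs.
From HB Require Import structures.
From mathcomp Require Import all_boot all_order all_algebra.
From mathcomp Require Import all_classical all_reals all_analysis.
From mathcomp Require Import measurable_realfun ring lra.
Import Order.TTheory GRing.Theory Num.Theory.
Local Open Scope classical_set_scope.
Local Open Scope ring_scope.

(** By flow conservation the pseudo-codeword [g] has total mass 1 on the edges of
    each time step, so the difference of the two costs is affine in the noise:
    it equals [2 <d, v> + |d|^2 + sigma_p^2] with [d = c - p].  The error event is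
    thus [<d, v> <= - (|d|^2 + sigma_p^2) / 2], and [<d, v>] is centered normal
    with standard deviation [sigma |d|]. *)

(* Bundled explicitly because the canonical instance on [pushforward] leaves the
   proof of measurability as an unresolved hole. *)
Definition pushforward_measure {d d'} {T1 : measurableType d} {T2 : measurableType d'}
    {R : realType} (mu : {measure set T1 -> \bar R}) (f : T1 -> T2)
    (mf : measurable_fun setT f) : {measure set T2 -> \bar R}.
Proof. unshelve refine (pushforward mu f : {measure set T2 -> \bar R}); exact mf. Defined.

(** * Affine changes of variable for Lebesgue measure and normal laws *)

Section normal_affine.
Context {R : realType}.
Local Notation mu := (@lebesgue_measure R).
Implicit Types (a b m s t z : R) (A : set R).

Definition affine a b (x : R) : R := a * x + b.

Lemma measurable_affine a b : measurable_fun setT (affine a b : R -> measurableTypeR R).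
Proof. by apply: measurable_funD => //; exact: measurable_funM. Qed.

(** The right-hand side is a measure in [A], a scaled pushforward, so comparing both sides on
    half-open intervals suffices. For [a < 0] the preimage is closed at the other end, which leaves
    its length unchanged. *)
Lemma lebesgue_measure_affine a b A : a != 0 -> measurable A ->
  mu A = (`|a|%:E * mu (affine a b @^-1` A))%E.
Proof.
move=> a0 mA.
pose nu := mscale (NngNum (normr_ge0 a)) (pushforward_measure mu _ (measurable_affine a b)).
rewrite -[RHS]/(nu A).
apply: lebesgue_measure_unique => // _ [[u v]] _ <-.
rewrite -[RHS]/(`|a|%:E * mu (affine a b @^-1` `]u, v]))%E.
have [a_lt0|a_gt0|a00] := ltgtP a 0; last by rewrite a00 eqxx in a0.
- rewrite (_ : affine a b @^-1` _ = `[(v - b) / a, (u - b) / a[%classic); last first.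
    apply/seteqP; split => y /=; rewrite /affine !in_itv/= ler_ndivrMr// ltr_ndivlMr//; lra.
  rewrite /= !lebesgue_measure_itv/= !lte_fin ltr_nM2r ?invr_lt0// ltrD2r.
  case: ifPn => uv; rewrite ?mule0//= -EFinM ltr0_norm//; congr EFin; field; lra.
- rewrite (_ : affine a b @^-1` _ = `](u - b) / a, (v - b) / a]%classic); last first.
    apply/seteqP; split => y /=; rewrite /affine !in_itv/= ler_pdivlMr// ltr_pdivrMr//; lra.
  rewrite /= !lebesgue_measure_itv/= !lte_fin ltr_pM2r ?invr_gt0// ltrD2r.
  case: ifPn => uv; rewrite ?mule0//= -EFinM gtr0_norm//; congr EFin; field; lra.
Qed.

Lemma normal_pdf_affine m s a b z : s != 0 -> a != 0 ->
  normal_pdf m s z = `|a| * normal_pdf (affine a b m) (a * s) (affine a b z).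
Proof.
move=> s0 a0; rewrite !normal_pdfE ?mulf_neq0// mulrA; congr (_ * _).
  rewrite /normal_peak (_ : (a * s) ^+ 2 * pi *+ 2 = a ^+ 2 * (s ^+ 2 * pi *+ 2)); last by ring.
  rewrite sqrtrM ?sqr_ge0// sqrtr_sqr invfM.
  by rewrite mulrA divff ?mul1r// normr_eq0.
by rewrite /normal_fun /affine; congr expR; field; rewrite s0 a0.
Qed.

(** Under the substitution Lebesgue measure gains a factor [|a|] and the density loses it. The scale
    [a * s] may be negative, which is harmless since the density sees only its square. *)
Lemma normal_prob_affine m s a b A : s != 0 -> a != 0 -> measurable A ->
  normal_prob m s (affine a b @^-1` A) = normal_prob (affine a b m) (a * s) A.
Proof.
move=> s0 a0 mA; rewrite /normal_prob.
pose nu := mscale (NngNum (normr_ge0 a)) (pushforward_measure mu _ (measurable_affine a b)).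
rewrite [RHS](@eq_measure_integral _ _ _ _ nu) //=; last first.
  by move=> B mB _; rewrite (lebesgue_measure_affine a b).
have mpdf : measurable_fun setT (fun x => (normal_pdf (affine a b m) (a * s) x)%:E).
  by apply/measurable_EFinP; exact: measurable_normal_pdf.
have pdf_ge0 x : (0 <= (normal_pdf (affine a b m) (a * s) x)%:E)%E.
  by rewrite lee_fin normal_pdf_ge0.
rewrite ge0_integral_mscale//; last exact: measurable_funTS.
rewrite ge0_integral_pushforward//; [|exact: measurable_affine|exact: measurable_funTS].
rewrite -ge0_integralZl//=.
- by apply: eq_integral => x _; rewrite -EFinM -normal_pdf_affine.
- by rewrite -[X in measurable X]setTI; exact: measurable_affine.
- by apply/measurable_funTS; apply: measurableT_comp mpdf _; exact: measurable_affine.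
Qed.
End normal_affine.

(** * Convolution of normal laws *)

Section normal_convolution.
Context {R : realType}.
Local Notation mu := (@lebesgue_measure R).
Implicit Types (m s t z : R) (A : set R).

(** The Radon-Nikodym derivative of the law agrees almost everywhere with [normal_pdf], because both
    have the same integral over every measurable set. *)
Lemma integral_normal_prob m s (f : R -> \bar R) :
  measurable_fun setT f -> (\int[normal_prob m s]_x `|f x| < +oo)%E ->
  (\int[normal_prob m s]_x f x = \int[mu]_x (f x * (normal_pdf m s x)%:E))%E.
Proof.
move=> mf foo; have dom := normal_prob_dominates m s.
have mpdf := (@measurable_normal_pdf R m s).
rewrite -(Radon_Nikodym_change_of_variables dom)//=; last by apply/integrableP; split.
apply: ae_eq_integral => //.
- by apply: emeasurable_funM => //; apply: (measurable_int mu); exact: Radon_Nikodym_integrable.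
- by apply: emeasurable_funM => //; exact/measurable_EFinP.
apply: ae_eqe_mul2l => /=; apply: integral_ae_eq => //=.
- exact: Radon_Nikodym_integrable.
- by apply/measurable_EFinP.
- by move=> E _ mE; rewrite -Radon_Nikodym_integral.
Qed.

(* Completing the square in [x] turns the joint density into the density of the sum [z]
   times a conditional density of [x], which integrates to 1. *)
Lemma normal_pdf_mul s t x z : s != 0 -> t != 0 ->
  let r := Num.sqrt (s ^+ 2 + t ^+ 2) in
  normal_pdf 0 s x * normal_pdf x t z =
  normal_pdf 0 r z * normal_pdf (z * s ^+ 2 / r ^+ 2) (s * t / r) x.
Proof.
move=> s0 t0 r.
have st_gt0 : 0 < s ^+ 2 + t ^+ 2 by rewrite addr_gt0// exprn_even_gt0.
have r2 : r ^+ 2 = s ^+ 2 + t ^+ 2 by rewrite sqr_sqrtr// ltW.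
have r0 : r != 0 by rewrite gt_eqF// sqrtr_gt0.
rewrite !normal_pdfE ?mulf_neq0 ?invr_eq0// mulrACA [RHS]mulrACA; congr (_ * _).
  have peak_ge0 (y : R) : 0 <= y ^+ 2 * pi *+ 2 by rewrite mulrn_wge0// mulr_ge0 ?sqr_ge0 ?pi_ge0.
  by rewrite /normal_peak -!invfM -!sqrtrM//; do 2 apply: congr1; field.
rewrite /normal_fun -!expRD; congr expR.
rewrite !exprMn exprVn r2; field.
by rewrite s0 t0 gt_eqF.
Qed.

Lemma normal_prob_indicE m s A : normal_prob m s A =
  (\int[mu]_z (normal_pdf m s z * \1_A z)%:E)%E.
Proof.
rewrite /normal_prob integral_mkcond epatch_indic.
by apply: eq_integral => z _ /=; rewrite EFinM.
Qed.

Lemma measurable_normal_pdf_mean t : t != 0 ->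
  measurable_fun setT (fun w : R * R => normal_pdf w.1 t w.2).
Proof.
move=> t0.
(* The density depends on the mean and the point only through their difference. *)
rewrite (_ : (fun w : R * R => _) = normal_pdf 0 t \o (fun w => w.2 - w.1)); last first.
  by apply/funext => w /=; rewrite !normal_pdfE// /normal_fun subr0.
by apply: measurableT_comp; [exact: measurable_normal_pdf|exact: measurable_funB].
Qed.

(** Lets the law be integrated over a random mean, as conditioning on one summand requires. By
    Tonelli, integrating out one variable of a jointly measurable density leaves a measurable
    function. *)
Lemma measurable_normal_prob_mean t A : t != 0 -> measurable A ->
  measurable_fun setT (fun x => normal_prob x t A).
Proof.
move=> t0 mA.
have mpdf : measurable_fun setT
    (fun w : R * R => (normal_pdf w.1 t w.2 * \1_A w.2)%:E).
  apply/measurable_EFinP/measurable_funM; first exact: measurable_normal_pdf_mean.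
  by apply: measurableT_comp => //; exact: measurable_indic.
have := measurable_fun_fubini_tonelli_F (m2 := mu) _ mpdf.
rewrite (_ : (fun x => normal_prob x t A) =
  fun x => (\int[mu]_z (normal_pdf x t z * \1_A z)%:E)%E); last first.
  by apply/funext => x; exact: normal_prob_indicE.
by apply => w; rewrite lee_fin mulr_ge0// normal_pdf_ge0.
Qed.

(** The left side is the law of a sum, conditioned on the value [x] of its first summand. It is
    written as a double integral over [x] and the value [z] of the sum, then swapped by Tonelli so
    that [normal_pdf_mul] applies for fixed [z]. *)
Lemma normal_prob_convolution s t A : s != 0 -> t != 0 -> measurable A ->
  (\int[normal_prob 0 s]_x normal_prob x t A =
   normal_prob 0 (Num.sqrt (s ^+ 2 + t ^+ 2)) A)%E.
Proof.
move=> s0 t0 mA; set r := Num.sqrt _.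
have r0 : r != 0 by rewrite gt_eqF// sqrtr_gt0 addr_gt0// exprn_even_gt0.
have mprob := @measurable_normal_prob_mean _ _ t0 mA.
rewrite integral_normal_prob//; last first.
  apply: (@le_lt_trans _ _ (\int[normal_prob 0%R s]_x 1)%E).
    apply: ge0_le_integral => //; first exact: measurableT_comp.
    by move=> x _; rewrite gee0_abs// probability_le1.
  rewrite integral_cst// mul1e; apply: le_lt_trans (ltry 1).
  exact: (@probability_le1 _ _ _ (normal_prob 0 s)).
pose f (w : R * R) := (normal_pdf w.1 t w.2 * \1_A w.2 * normal_pdf 0 s w.1)%:E.
have mindic : measurable_fun setT (fun w : R * R => \1_A w.2 : R).
  by apply: measurableT_comp => //; exact: measurable_indic.
have mf : measurable_fun setT f.
  apply/measurable_EFinP/measurable_funM; last first.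
    by apply: measurableT_comp => //; exact: measurable_normal_pdf.
  by apply: measurable_funM => //; exact: measurable_normal_pdf_mean.
have f0 w : (0 <= f w)%E by rewrite lee_fin !mulr_ge0// normal_pdf_ge0.
transitivity (\int[mu]_x \int[mu]_z f (x, z))%E.
  apply: eq_integral => x _; rewrite normal_prob_indicE -ge0_integralZr//=.
  - by apply/measurable_EFinP/measurable_funM;
      [exact: measurable_normal_pdf|exact: measurable_indic].
  - by move=> z _; rewrite lee_fin mulr_ge0// normal_pdf_ge0.
  - by rewrite lee_fin normal_pdf_ge0.
rewrite (fubini_tonelli (m1 := mu) (m2 := mu) f mf f0) normal_prob_indicE.
apply: eq_integral => z _; rewrite /f/=.
(* The density of the sum leaves the integral over [x]; a conditional density of total mass 1
   remains. *)
under eq_integral do rewrite mulrAC [_ * normal_pdf 0 s _]mulrC normal_pdf_mul// mulrAC EFinM.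
rewrite ge0_integralZl//=.
- by rewrite integral_normal_pdf mule1.
- by apply/measurable_EFinP; exact: measurable_normal_pdf.
- by move=> x _; rewrite lee_fin normal_pdf_ge0.
- by rewrite lee_fin mulr_ge0// normal_pdf_ge0.
Qed.

End normal_convolution.

(** The density involves the scale only through its square, which also detects the degenerate scale
    0. This removes the signs that affine maps put into the scale. *)
Lemma normal_prob_sqr {R : realType} (m s s' : R) :
  s ^+ 2 = s' ^+ 2 -> normal_prob m s = normal_prob m s'.
Proof.
move=> ss'; apply/funext => A; apply: eq_integral => z _; congr EFin.
rewrite /normal_pdf -(sqrf_eq0 s) ss' sqrf_eq0; case: ifP => // _.
by rewrite /normal_peak /normal_fun ss'.
Qed.

(** * Linear combinations of independent normal variables *)

Section independent_normal_sum.
Context {R : realType} (n : nat) (sigma : R) (d : 'I_n -> R).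
Context (disp : measure_display) (T : measurableType disp) (P : probability T R).
Context (v : 'I_n -> {RV P >-> R}).
Hypothesis sigma_gt0 : 0 < sigma.
Hypothesis indep : mutually_independent P (fun i => v i : T -> R).
Hypothesis normal_v : forall (i : 'I_n) (A : set R), measurable A ->
  P (v i @^-1` A) = normal_prob 0 sigma A.
Implicit Types (r : seq 'I_n) (A Y : set R) (B : 'I_n -> set R).

Let rest r B := [set w | forall j, j \notin r -> B j (v j w)].

Let measurable_rest r B : (forall j, measurable (B j)) -> measurable (rest r B).
Proof.
move=> mB; rewrite (_ : rest r B = \bigcap_(j in [set j | j \notin r]) (v j @^-1` B j)).
  apply: fin_bigcap_measurable => [|j _]; first exact: finite_finset.
  by rewrite -[X in measurable X]setTI; exact: measurable_funP.
by apply/seteqP; split => w rw j; exact: rw.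
Qed.

(** Mutual independence is used twice, for the indices outside [r] and for those outside [i :: r];
    the two products differ by the factor at [i]. *)
Let indep_cons i r Y B : i \notin r -> measurable Y -> (forall j, measurable (B j)) ->
  P (v i @^-1` Y `&` rest (i :: r) B) = (normal_prob 0 sigma Y * P (rest (i :: r) B))%E.
Proof.
move=> ir mY mB; rewrite -(normal_v i) //.
(* Folding the condition on [v i] into the family turns the intersection into a single product
   event. *)
pose B' j := if j == i then Y else B j.
have mB' j : measurable (B' j) by rewrite /B'; case: ifP.
have -> : rest (i :: r) B =
    [set w | forall j, j \in [set j | j \notin i :: r]%SET -> B j (v j w)].
  by apply/seteqP; split => w rw j; have := rw j; rewrite finset.in_set; exact.
have -> : v i @^-1` Y `&` [set w | forall j, j \in [set j | j \notin i :: r]%SET -> B j (v j w)] =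
    [set w | forall j, j \in [set j | j \notin r]%SET -> B' j (v j w)].
  apply/seteqP; split => [w [Yw rw] j|w rw]; rewrite ?finset.in_set.
    move=> jr; rewrite /B'; case: eqVneq => [->//|ji]; apply: rw.
    by rewrite finset.in_set in_cons negb_or ji.
  split; first by have := rw i; rewrite finset.in_set /B' eqxx; exact.
  move=> j; rewrite finset.in_set in_cons negb_or => /andP[ji jr].
  by have := rw j; rewrite finset.in_set /B' (negbTE ji); exact.
rewrite !indep// (bigD1 i) ?inE//=; congr (_ * _)%E.
  by rewrite /B' eqxx.
apply: eq_big => [j|j /andP[_ ji]]; first by rewrite !inE negb_or andbC.
by rewrite /B' (negbTE ji).
Qed.

Let measurable_sum r : measurable_fun setT (fun w => \sum_(i <- r) d i * v i w).
Proof.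
by apply: measurable_sum => i; apply: measurable_funM => //; exact: measurable_funP.
Qed.

(* The events on the indices outside [r] are carried along so that the induction itself
   yields the independence of the partial sum from the next variable.  Zero coefficients
   are excluded because [normal_prob _ 0] is the uniform law on [0, 1], not a Dirac mass. *)
Lemma indep_sum_normal r A B : uniq r -> r != [::] -> (forall i, i \in r -> d i != 0) ->
  measurable A -> (forall j, measurable (B j)) ->
  P ([set w | A (\sum_(i <- r) d i * v i w)] `&` [set w | forall j, j \notin r -> B j (v j w)]) =
  (normal_prob 0 (sigma * Num.sqrt (\sum_(i <- r) d i ^+ 2)) A *
   P [set w | forall j, j \notin r -> B j (v j w)])%E.
Proof.
have sigma0 : sigma != 0 by rewrite gt_eqF.
elim: r => // i r IH in A B * => /= /andP[ir ur] _ d0 mA mB.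
have di0 : d i != 0 by apply: d0; rewrite mem_head.
rewrite -!/(rest _ _).
have maffine z C : measurable C -> measurable (affine (d i) z @^-1` C).
  by move=> mC; rewrite -[X in measurable X]setTI; exact: measurable_affine.
(* The induction starts at one term, since the law of an empty sum is a Dirac mass. *)
have [->|r0] := eqVneq r [::].
  under eq_fun do rewrite big_seq1.
  rewrite big_seq1 (_ : [set w | _] = v i @^-1` (affine (d i) 0 @^-1` A)); last first.
    by apply/seteqP; split => w /=; rewrite /affine addr0.
  rewrite indep_cons//; last exact: maffine.
  rewrite normal_prob_affine// /affine mulr0 addr0.
  congr (_ * _)%E; rewrite (@normal_prob_sqr _ _ _ (sigma * Num.sqrt (d i ^+ 2)))//.
  by rewrite !exprMn sqr_sqrtr ?sqr_ge0// mulrC.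
have {}IH A' B' : measurable A' -> (forall j, measurable (B' j)) -> _ :=
  IH A' B' ur r0 (fun j jr => d0 j (mem_behead (s := i :: r) jr)).
set s := sigma * Num.sqrt (\sum_(j <- r) d j ^+ 2) in IH.
have sum_ge0 : 0 <= \sum_(j <- r) d j ^+ 2 by apply: sumr_ge0 => j _; exact: sqr_ge0.
have s0 : s != 0.
  rewrite mulf_neq0// gt_eqF// sqrtr_gt0 lt_neqAle sum_ge0 andbT eq_sym.
  rewrite psumr_eq0 => [|j _]; last exact: sqr_ge0.
  case: r r0 d0 {ir ur IH s sum_ge0} => // j r _ d0 /=.
  by rewrite sqrf_eq0 negb_and d0// !inE eqxx orbT.
have mD := measurable_rest (i :: r) B mB.
pose k := NngNum (fine_ge0 (measure_ge0 P (rest (i :: r) B))).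
pose phi w := (\sum_(j <- r) d j * v j w, v i w).
have mphi : measurable_fun setT phi.
  by apply/measurable_fun_pairP; split; [exact: measurable_sum|exact: measurable_funP].
pose C := [set z : R * R | A (affine (d i) z.1 z.2)].
have mC : measurable C.
  rewrite -[X in measurable X]setTI; apply: (_ : measurable_fun setT _) => //.
  by apply: measurable_funD => //; apply: measurable_funM.
(* The law of the partial sum is scaled by the probability [k] of the event outside [i :: r], to
   match the total mass of the restricted joint law [nu]. *)
pose N1 : {sigma_finite_measure set (measurableTypeR R) -> \bar R} := mscale k (normal_prob 0 s).
pose N2 : {sigma_finite_measure set (measurableTypeR R) -> \bar R} := normal_prob 0 sigma.
have -> : [set w | A (\sum_(i0 <- i :: r) d i0 * v i0 w)] = phi @^-1` C.
  by apply/seteqP; split => w /=; rewrite big_cons.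
pose nu := @pushforward_measure _ _ _ (measurableTypeR R * measurableTypeR R)%type _
  (mrestr P mD) phi mphi.
(* On that event, the joint law of the partial sum and [v i] is the product of [N1] and [N2], by
   uniqueness from rectangles. Hence [nu C] is an iterated integral, and its sections turn it into a
   convolution. *)
rewrite -[LHS]/(nu C) -(@product_measure_unique _ _ _ _ _ N1 N2 nu) //.
- rewrite /product_measure1/=.
  under eq_integral => x _.
    rewrite (_ : xsection C x = affine (d i) x @^-1` A); last first.
      by apply/seteqP; split => y; rewrite /xsection/= inE.
    rewrite normal_prob_affine// /affine mulr0 add0r.
    over.
  rewrite ge0_integral_mscale//=; last first.
    exact: (measurable_normal_prob_mean _ _ (mulf_neq0 di0 sigma0) mA).
  rewrite fineK; last exact: fin_num_measure.
  rewrite (normal_prob_convolution _ _ _ s0 (mulf_neq0 di0 sigma0) mA) muleC.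
  congr (_ * _)%E; congr (normal_prob _ _ _).
  rewrite big_cons /s !exprMn sqr_sqrtr// [_ + _ ^+ 2 * _]addrC.
  rewrite [d i ^+ 2 * _]mulrC -mulrDr sqrtrM ?sqr_ge0// sqrtr_sqr gtr0_norm//.
- move=> X Y mX mY.
  (* On a rectangle, the condition [Y] on [v i] joins the outside events of the induction
     hypothesis, as [i] is not in [r]. *)
  pose B' j := if j == i then Y else B j.
  have mB' j : measurable (B' j) by rewrite /B'; case: ifP => _; [exact: mY|exact: mB].
  have restE : rest r B' = v i @^-1` Y `&` rest (i :: r) B.
    apply/seteqP; split => [w rw|w [Yw rw] j jr].
      split; first by have := rw i ir; rewrite /B' eqxx.
      move=> j; rewrite in_cons negb_or => /andP[ji jr].
      by have := rw j jr; rewrite /B' (negbTE ji).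
    by rewrite /B'; case: eqVneq => [->//|ji]; apply: rw; rewrite in_cons negb_or ji.
  have := IH X B' mX mB'; rewrite -/(rest r B') restE indep_cons// setIA => IHX.
  rewrite [LHS]IHX /N1/= /mscale/= fineK; last exact: fin_num_measure.
  by rewrite [(_ * P _)%E]muleC muleCA -muleA.
Qed.
End independent_normal_sum.

(** * Gaussian tails and the Q function *)

Lemma normal_prob_lower_tail {R : realType} (s b : R) : 0 < s ->
  normal_prob 0 s `]-oo, - b] = Qfun (b / s).
Proof.
move=> s0; have sN0 : - s != 0 by rewrite oppr_eq0 gt_eqF.
(* The factor [- s] reflects and rescales at once: it carries the standard normal law to scale [s]
   and the upper tail from [b / s] to the lower tail up to [- b]. *)
have := @normal_prob_affine R 0 1 (- s) 0 `]-oo, - b] (oner_neq0 _) sN0 (measurable_itv _).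
rewrite /affine mulr0 addr0 mulr1 (@normal_prob_sqr _ _ (- s) s) ?sqrrN// => <-.
rewrite (_ : _ @^-1` _ = `[b / s, +oo[%classic); last first.
  by apply/seteqP; split => u /=; rewrite !in_itv/= andbT ler_pdivrMr// addr0 mulNr lerN2 mulrC.
rewrite /normal_prob /Qfun; apply: eq_integral => u _.
by rewrite normal_pdfE ?oner_neq0// /normal_peak /normal_fun expr1n mul1r subr0 mulNr.
Qed.

Lemma indep_normal_linear_tail {R : realType} (n : nat) (sigma b : R) (d : 'I_n -> R)
    (disp : measure_display) (T : measurableType disp) (P : probability T R)
    (v : 'I_n -> {RV P >-> R}) : 0 < sigma ->
  mutually_independent P (fun i => v i : T -> R) ->
  (forall (i : 'I_n) (A : set R), measurable A -> P (v i @^-1` A) = normal_prob 0 sigma A) ->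
  (exists i, d i != 0) ->
  P [set w | \sum_(i < n) d i * v i w <= - b] =
  Qfun (b / (sigma * Num.sqrt (\sum_(i < n) d i ^+ 2))).
Proof.
move=> sigma_gt0 indep normal_v [i0 di0].
(* Only nonzero coefficients are kept, as [indep_sum_normal] demands; the dropped terms contribute
   nothing to either sum. *)
pose r := [seq i <- index_enum 'I_n | d i != 0].
have r0 : r != [::] by rewrite -has_filter; apply/hasP; exists i0; rewrite ?mem_index_enum.
have ur : uniq r by rewrite filter_uniq ?index_enum_uniq.
have rd0 i : i \in r -> d i != 0 by rewrite mem_filter => /andP[].
have big_r (F : 'I_n -> R) : (forall i, d i = 0 -> F i = 0) ->
    \sum_(i <- r) F i = \sum_(i < n) F i.
  move=> F0; rewrite big_filter big_mkcond; apply: eq_bigr => i _.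
  by case: eqVneq => //= /F0.
have d2_gt0 : 0 < \sum_(i < n) d i ^+ 2.
  rewrite (bigD1 i0)//= ltr_pwDl ?exprn_even_gt0//.
  by apply: sumr_ge0 => i _; exact: sqr_ge0.
(* With every outside event equal to [setT], only the law of the sum remains. *)
have := @indep_sum_normal R n sigma d _ T P v sigma_gt0 indep normal_v
  r `]-oo, - b] (fun=> setT) ur r0 rd0 (measurable_itv _) (fun=> measurableT).
rewrite (_ : [set w | forall j, _ -> [set: R] (v j w)] = setT); last by apply/seteqP.
rewrite setIT probability_setT mule1 big_r; last by move=> i ->; rewrite expr0n.
rewrite normal_prob_lower_tail ?mulr_gt0 ?sqrtr_gt0// => <-; congr (P _).
apply/seteqP; split => w /=; rewrite in_itv/= big_r// => i ->; exact: mul0r.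
Qed.

(** * Flow conservation and the cost difference *)

Section trellis.
Context {R : realType} (n : nat) (St : finType) (eta : bool -> St -> St)
  (alpha : St -> bool -> R) (S0 : {set St}) (g : edge n St -> R).

(** Induction on time: the edges at time [k] are grouped by ending state and those at time [k.+1] by
    starting state, and flow conservation equates the groups. *)
Lemma trellis_mass (i : 'I_n) : in_trellis_polytope eta S0 g ->
  \sum_(e | in_E S0 e && (e_t e == i)) g e = 1.
Proof.
case=> _ [g0 gS].
suff mass k : (k < n)%N -> \sum_(e | in_E S0 e && (val (e_t e) == k)) g e = 1.
  by rewrite -(mass i).
elim: k => // k IH kn; rewrite -(IH (ltnW kn)).
rewrite [RHS](partition_big (e_s' eta) predT)//= [LHS](partition_big (@e_s n St) predT)//=.
apply: eq_bigr => j _.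
transitivity (\sum_(e | [&& in_E S0 e, val (e_t e) == k.+1 & e_s e == j]) g e).
  by apply: eq_bigl => e; rewrite andbA.
by rewrite -gS//; apply: eq_bigl => e; rewrite andbA.
Qed.

Lemma trellis_cost_diff (c v : 'I_n -> R) : in_trellis_polytope eta S0 g ->
  let p := sig_proj alpha S0 g in
  \sum_(e | in_E S0 e) g e * (c (e_t e) + v (e_t e) - e_a alpha e) ^+ 2
    - \sum_(i < n) (c i + v i - c i) ^+ 2 =
  2 * \sum_(i < n) (c i - p i) * v i + (dist2 c p + sigma_p2 alpha S0 g).
Proof.
move=> hg p.
have split_time (F : edge n St -> R) :
    \sum_(e | in_E S0 e) F e = \sum_(i < n) \sum_(e | in_E S0 e && (e_t e == i)) F e.
  exact: (partition_big (@e_t n St) predT).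
have cost i : \sum_(e | in_E S0 e && (e_t e == i)) g e * (c (e_t e) + v (e_t e) - e_a alpha e) ^+ 2
      - (c i + v i - c i) ^+ 2 = 2 * ((c i - p i) * v i) + ((c i - p i) ^+ 2 +
    (\sum_(e | in_E S0 e && (e_t e == i)) g e * e_a alpha e ^+ 2 - p i ^+ 2)).
  (* Expanding the square around the received symbol, unit mass sums the first term to
     [(c i + v i) ^+ 2] and the second involves only [p i], so the quadratic noise terms cancel. *)
  rewrite (eq_bigr (fun e => (c i + v i) ^+ 2 * g e - 2 * (c i + v i) * (g e * e_a alpha e) +
    g e * e_a alpha e ^+ 2)); last by move=> e /andP[_ /eqP ->]; ring.
  rewrite big_split/= sumrB -!mulr_sumr trellis_mass// -/(sig_proj alpha S0 g i) -/(p i).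
  ring.
rewrite split_time -sumrB (eq_bigr _ (fun i _ => cost i)) big_split/= -mulr_sumr; congr (_ + _).
by rewrite big_split/= sumrB -split_time.
Qed.
End trellis.

(** * The pairwise error probability *)

Theorem theorem5 (R : realType) (m n : nat) (H : 'M['F_2]_(m, n))
  (St : finType) (eta : bool -> St -> St) (alpha : St -> bool -> R) (S0 : {set St})
  (sigma : R) (hsigma : 0 < sigma)
  (x : 'I_n -> bool) (hx : is_codeword H x)
  (s1 : St) (hs1 : s1 \in S0)
  (g : edge n St -> R) (hg : in_PT eta S0 H g)
  (hpc : sig_proj alpha S0 g <> sig_codeword eta alpha s1 x)
  (d : measure_display) (T : measurableType d) (P : probability T R)
  (v : 'I_n -> {RV P >-> R})
  (hind : mutually_independent P (fun i => v i : T -> R))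
  (hgauss : forall (i : 'I_n) (A : set R), measurable A ->
              P (v i @^-1` A) = normal_prob 0 sigma A) :
  let c := sig_codeword eta alpha s1 x in
  let p := sig_proj alpha S0 g in
  let y := fun (i : 'I_n) (w : T) => c i + v i w in
  P [set w | \sum_(e | in_E S0 e) g e * (y (e_t e) w - e_a alpha e) ^+ 2
             <= \sum_(i < n) (y i w - c i) ^+ 2]
  = Qfun (d_gen c p (sigma_p2 alpha S0 g) / (2 * sigma)).
Proof.
move=> c p y; set sp2 := sigma_p2 alpha S0 g.
have diff_neq0 : exists i, c i - p i != 0.
  apply/not_existsP => cp; apply: hpc; apply/funext => i; apply/eqP.
  by have /negP := cp i; rewrite negbK subr_eq0 eq_sym.
(* This exposes the threshold [b = (dist2 c p + sp2) / 2] over the standard deviation of the linear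
   noise term. *)
rewrite (_ : d_gen c p sp2 / (2 * sigma) =
    ((dist2 c p + sp2) / 2) / (sigma * Num.sqrt (dist2 c p))); last first.
  by rewrite /d_gen !invfM; ring.
rewrite -(@indep_normal_linear_tail R n sigma _ (fun i => c i - p i) _ T P v)//.
congr (P _); apply/funext => w /=; rewrite /mkset; congr is_true; rewrite -subr_le0.
have /= -> := @trellis_cost_diff _ _ _ eta _ _ _ c (fun i => v i w) hg.1.
by rewrite -/p -/sp2; apply/idP/idP; lra.
Qed.
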